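(* Let $N\ge2$ and fix $a_N\in\mathbb{R}$ (not depending on $\beta$). For each $\beta>0$ and each $\boldsymbol{\mu}=(\mu_1>\cdots>\mu_{N-1})$, let $\boldsymbol{\lambda}=(\lambda_1\ge\cdots\ge\lambda_N)$ be the ordered $N$ roots of the random equation $$\sum_{i=1}^{N-1}\frac{\xi_i}{x-\mu_i}=x-\xi_N,$$ where $\xi_1,\ldots,\xi_N$ are independent, $\xi_i\sim\frac12\chi_\beta^2$ for $i=1,\ldots,N-1$, and $\xi_N\sim\mathcal{N}(a_N,1)$. Then, as $\beta\to\infty$: (i) If $\boldsymbol{\mu}$ does not depend on $\beta$, then the $N-2$ inner roots $\lambda_2,\ldots,\lambda_{N-1}$ converge in probability to the roots of $P_{\boldsymbol{\mu}}'$, that is, of $$\sum_{i=1}^{N-1}\frac{1}{x-\mu_i}=0,$$ one per gap $(\mu_{i+1},\mu_i)$, while the two outer roots escape: $$\frac{\lambda_1}{\sqrt\beta}\to\sqrt{\frac{N-1}{2}},\qquad \frac{\lambda_N}{\sqrt\beta}\to-\sqrt{\frac{N-1}{2}}\qquad\text{in probability}.$$ (ii) If instead $\mu_i=\sqrt\beta\,m_i$ with $\mathbf{m}=(m_1>\cdots>m_{N-1})$ fixed, then the whole rescaled row $\boldsymbol{\lambda}/\sqrt\beta$ converges in probability to the $N$ roots of $$P_{\mathbf{m}}'(x)-2xP_{\mathbf{m}}(x)=e^{x^2}\frac{d}{dx}\bigl[e^{-x^2}P_{\mathbf{m}}(x)\bigr]=0,$$ and these $N$ roots interlace with $\mathb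f{m}$.
   Context: For a tuple $\mathbf{w}=(w_1,\ldots,w_{N-1})$, $P_{\mathbf{w}}(x)=\prod_{i=1}^{N-1}(x-w_i)$. The law $\frac12\chi^2_\beta$ (chi-squared with real parameter $\beta>0$, halved) is the Gamma distribution with density $\Gamma(\beta/2)^{-1}x^{\beta/2-1}e^{-x}$ on $x>0$. The equation is equivalent, after clearing denominators, to $\prod_{i=1}^{N-1}(x-\mu_i)(x-\xi_N)-\sum_{i=1}^{N-1}\xi_i\prod_{k\ne i}(x-\mu_k)=0$; its $N$ roots are real. (The resulting law of $\boldsymbol{\lambda}$ is the conditional law of the top row given the next row $\boldsymbol{\mu}$ in the perturbed Gaussian $\beta$-corners process.) A tuple $(r_1\ge\cdots\ge r_N)$ interlaces with $\mathbf{m}$ if $r_1\ge m_1\ge r_2\ge\cdots\ge m_{N-1}\ge r_N$. *)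

(* Defs.v *)
From HB Require Import structures.
From mathcomp Require Import all_boot all_order all_algebra.
From mathcomp Require Import all_classical all_reals all_analysis.

Set Implicit Arguments.
Unset Strict Implicit.
Unset Printing Implicit Defensive.

Import Order.TTheory GRing.Theory Num.Theory.
Import numFieldNormedType.Exports.

Local Open Scope classical_set_scope.
Local Open Scope ring_scope.

(* Tuples are 0-based: the paper's [w_(i+1)] is [w i].  For [i : 'I_k], [cur i]
   and [nxt i] are the positions [i] and [i + 1] of a tuple of length [k + 1]. *)
Definition cur k (i : 'I_k) : 'I_k.+1 := widen_ord (leqnSn k) i.
Definition nxt k (i : 'I_k) : 'I_k.+1 := lift ord0 i.

Definition decreasing_tuple (R : realType) k (w : 'I_k -> R) : Prop :=
  forall i j : 'I_k, (i < j)%N -> w j < w i.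

Definition nonincreasing_tuple (R : realType) k (w : 'I_k -> R) : Prop :=
  forall i j : 'I_k, (i <= j)%N -> w j <= w i.

Definition interlaces (R : realType) k (r : 'I_k.+1 -> R) (m : 'I_k -> R) :
    Prop :=
  forall i : 'I_k, m i <= r (cur i) /\ r (nxt i) <= m i.

Definition Ppoly (R : realType) k (w : 'I_k -> R) : {poly R} :=
  \prod_(i < k) ('X - (w i)%:P).

(* [r] lists all the roots of [p] with multiplicity, so [p] splits over [R]. *)
Definition ordered_poly_roots (R : realType) k (p : {poly R}) (r : 'I_k -> R) :
    Prop :=
  nonincreasing_tuple r /\ p = lead_coef p *: Ppoly r.

(* The equation  \sum_i xi_i / (x - mu_i) = x - xi_N  with N = n + 2; the first
   conjunct is needed because division by zero is total. *)
Definition corner_equation (R : realType) n (mu : 'I_n.+1 -> R)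
    (xi : 'I_n.+2 -> R) (x : R) : Prop :=
  (forall i, x != mu i) /\
  \sum_(i < n.+1) xi (cur i) / (x - mu i) = x - xi ord_max.

(* When xi_1, ..., xi_(N-1) > 0 the equation has exactly N distinct real
   solutions, so that the N-tuple [lambda] is then determined, without
   repetition, by its set of values. *)
Definition ordered_corner_roots (R : realType) n (mu : 'I_n.+1 -> R)
    (xi lambda : 'I_n.+2 -> R) : Prop :=
  nonincreasing_tuple lambda /\
  forall x, corner_equation mu xi x <-> exists i, x = lambda i.

Definition gamma_fun (R : realType) (s : R) : R :=
  (\int[lebesgue_measure]_(t in `]0, +oo[) (t `^ (s - 1) * expR (- t)))%R.

Definition half_chi2_pdf (R : realType) (b x : R) : R :=
  if 0 < x then (gamma_fun (b / 2))^-1 * x `^ (b / 2 - 1) * expR (- x) else 0.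

Definition half_chi2_prob (R : realType) (b : R) (A : set R) : \bar R :=
  (\int[lebesgue_measure]_(x in A) (half_chi2_pdf b x)%:E)%E.

(* Testing events on all indices at once gives the product rule for every
   subfamily, taking [A i = setT] for the other indices. *)
Definition mutually_independent (R : realType) (d : measure_display)
    (T : measurableType d) (P : probability T R) k
    (X : 'I_k -> {RV P >-> R}) : Prop :=
  forall A : 'I_k -> set R, (forall i, measurable (A i)) ->
  P [set w | forall i, A i (X i w)] = (\prod_(i < k) P (X i @^-1` A i))%E.

Definition cvg_in_prob (R : realType) (d : R -> measure_display)
    (T : forall b, measurableType (d b)) (P : forall b, probability (T b) R)
    (X : forall b, T b -> R) (c : R) : Prop :=
  forall eps : R, 0 < eps ->
  P b [set w | eps < `|X b w - c|] @[b --> +oo%R] --> 0%E.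

(* Convergence in probability of a random k-tuple for the sup norm. *)
Definition tuple_cvg_in_prob (R : realType) (d : R -> measure_display)
    (T : forall b, measurableType (d b)) (P : forall b, probability (T b) R)
    k (X : forall b, 'I_k -> T b -> R) (c : 'I_k -> R) : Prop :=
  forall eps : R, 0 < eps ->
  P b [set w | exists i, eps < `|X b i w - c i|] @[b --> +oo%R] --> 0%E.

(* Main.v *)
Require Import Defs.
From HB Require Import structures.
From mathcomp Require Import all_boot all_order all_algebra.
From mathcomp Require Import all_classical all_reals all_analysis.
From mathcomp Require Import measurable_realfun lra ring.

Set Implicit Arguments.
Unset Strict Implicit.
Unset Printing Implicit Defensive.

Import Order.TTheory GRing.Theory Num.Theory.
Import numFieldNormedType.Exports.

Local Open Scope classical_set_scope.
Local Open Scope ring_scope.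

(** Write the random equation as h(x) = 0 for the secular function
      h(x) = a x - c - sum_i w_i / (x - m_i),
    here with a = 1, c = xi_N, w_i = xi_i and m_i = mu_i. When a >= 0 and all
    weights are positive, h is strictly increasing on each of the k + 1 intervals
    cut out by the k poles m_i, and it changes sign on each of them, except on the
    two unbounded ones when a = 0. For a = 1 each interval thus contains exactly
    one zero, and lambda_j is the zero in the j-th interval (secular_lt,
    secular_root, corner_roots_in_gap).

    Monotonicity also makes each zero a continuous function of the parameters
    (a, c, w, m): if h < 0 just left of a zero and h > 0 just right of it, the
    same holds after a small perturbation, and the perturbed zero is trapped in
    between (secular_root_cvg). Substituting x = s y and multiplying the equation
    by s / beta turns the parameters into
      a = s^2 / beta, c = (s / beta) xi_N, w_i = xi_i / beta, m_i = mu_i / s.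
    Since xi_i / beta -> 1/2 and xi_N / sqrt beta -> 0 in probability, taking
    s = 1 gives in the limit the equation sum_i 1 / (y - mu_i) = 0 of the inner
    roots; s = sqrt beta with mu fixed merges all the poles at 0 and gives
    y = (N - 1) / (2 y), that is y = +- sqrt ((N - 1) / 2), for the outer roots;
    s = sqrt beta with mu = sqrt beta m gives 2 y = sum_i 1 / (y - m_i). The
    polynomials of the statement are the first and the last of these equations,
    cleared of their denominators (horner_secular_poly), and the gaps provide as
    many distinct real roots as the degree, so that they split
    (secular_gap_roots).

    Convergence in probability is treated as convergence along a filter on the
    disjoint union of the sample spaces, that of the sets containing all outcomes
    outside events B_beta with P_beta(B_beta) -> 0, for large beta. The stability of the zeros,
    which holds along an arbitrary filter, then applies as it is
    (scaled_root_cvg).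

    The law of large numbers xi_i / beta -> 1/2 is Chebyshev's inequality for the
    Gamma law of parameter s = beta / 2, whose variance is s. The variance bound
    comes from the identity
      d/dx [- (x - s + 1) x^s e^-x] = ((x - s)^2 - s) x^(s-1) e^-x
    integrated over [0, L]: the bracket vanishes at 0 and is nonpositive at L, so
    that the normalisation of the density yields the bound
    (half_chi2_truncated_variance, half_chi2_chebyshev). *)

(** * The secular function *)

(** Rational functions of this form appear as characteristic equations of
    bordered diagonal matrices, where they are called secular functions. *)
Definition secular (R : realType) k (a c : R) (w m : 'I_k -> R) (x : R) : R :=
  a * x - c - \sum_(i < k) w i / (x - m i).

(** For decreasing [m] of length [k] these are the [k + 1] intervals of the
    complement of the poles, numbered from the right: gap [0] lies above every
    [m i] and gap [k] below. The definition makes sense for arbitrary [m], which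
    lets all the poles collapse to one point in a limit. *)
Definition in_gap (R : realType) k (m : 'I_k -> R) (j : nat) (x : R) : Prop :=
  forall i : 'I_k, if (i < j)%N then x < m i else m i < x.

Lemma cvg_sumr (R : realType) (T I : Type) (F : set_system T) {FF : Filter F}
    (r : seq I) (P : pred I) (f : I -> T -> R) (l : I -> R) :
  (forall i, P i -> f i t @[t --> F] --> l i) ->
  \sum_(i <- r | P i) f i t @[t --> F] --> \sum_(i <- r | P i) l i.
Proof. exact: (cvg_big (@add_continuous R) FF). Qed.

Section Secular.
Variables (R : realType) (k : nat).
Implicit Types (a c x y : R) (w m : 'I_k -> R) (j : nat).

Lemma in_gap_neq m j x i : in_gap m j x -> x - m i != 0.
Proof.
by move=> /(_ i); case: ifP => _ h; rewrite subr_eq0; [rewrite lt_eqF|rewrite gt_eqF].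
Qed.

Lemma in_gap_between m j x y z : in_gap m j x -> in_gap m j y ->
  x <= z <= y -> in_gap m j z.
Proof.
move=> gx gy /andP[xz zy] i; have := gx i; have := gy i.
case: ifP => _ hy hx; first exact: le_lt_trans hy.
exact: lt_le_trans xz.
Qed.

Lemma secular_le a c w m j x y : 0 <= a -> (forall i, 0 <= w i) ->
  in_gap m j x -> in_gap m j y -> x <= y ->
  secular a c w m x <= secular a c w m y.
Proof.
move=> a0 w0 gx gy xy; rewrite /secular lerB//.
  by rewrite lerB// ler_wpM2l.
apply: ler_sum => i _; apply: ler_wpM2l => //.
have := gx i; have := gy i; case: ifP => _ hy hx; last first.
  by rewrite lef_pV2 ?posrE ?subr_gt0// lerB.
by rewrite lef_nV2 ?negrE ?subr_lt0// lerB.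
Qed.

(** Each term [- w i / (x - m i)] increases as long as [x] does not cross the
    pole; a single pole makes the inequality strict even when [a = 0]. *)
Lemma secular_lt a c w m j x y : (0 < k)%N -> 0 <= a -> (forall i, 0 < w i) ->
  in_gap m j x -> in_gap m j y -> x < y ->
  secular a c w m x < secular a c w m y.
Proof.
move=> k0 a0 w0 gx gy xy; rewrite /secular ler_ltB//.
  by rewrite lerB// ler_wpM2l// ltW.
pose i0 := Ordinal k0; apply: ltr_sum => [|i _].
  by apply/hasP; exists i0; rewrite ?mem_index_enum.
rewrite ltr_pM2l//.
have := gx i; have := gy i; case: ifP => _ hy hx; last first.
  by rewrite ltf_pV2 ?posrE ?subr_gt0// ltrD2r.
by rewrite ltf_nV2 ?negrE ?subr_lt0// ltrD2r.
Qed.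

Lemma secular_cvg (T : Type) (F : set_system T) {FF : Filter F}
    (at_ ct xt : T -> R) (wt mt : T -> 'I_k -> R) a c w m x :
  at_ t @[t --> F] --> a -> ct t @[t --> F] --> c -> xt t @[t --> F] --> x ->
  (forall i, wt t i @[t --> F] --> w i) -> (forall i, mt t i @[t --> F] --> m i) ->
  (forall i, x - m i != 0) ->
  secular (at_ t) (ct t) (wt t) (mt t) (xt t) @[t --> F] --> secular a c w m x.
Proof.
move=> ha hc hx hw hm xm; rewrite /secular; apply: cvgB.
  by apply: cvgB => //; apply: cvgM.
apply: cvg_sumr => i _.
by apply: cvgM => //; apply: cvgV => //; apply: cvgB.
Qed.

Lemma secular_continuous a c w m x : (forall i, x - m i != 0) ->
  secular a c w m y @[y --> x] --> secular a c w m x.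
Proof.
by move=> xm; apply: secular_cvg => //; move=> *; exact: cvg_cst.
Qed.

(** Reflection exchanges the two unbounded gaps. *)
Lemma secular_opp a c w m x :
  secular a (- c) w (fun i => - m i) (- x) = - secular a c w m x.
Proof.
rewrite /secular; under eq_bigr do rewrite -opprD invrN mulrN.
by rewrite sumrN; ring.
Qed.

(** At distance at least 1 from all the poles the sum is at most the total
    weight, which the linear term eventually dominates. *)
Lemma secular_gt0_large a c w m : 0 < a -> (forall i, 0 <= w i) ->
  exists2 x, forall i, m i < x & 0 < secular a c w m x.
Proof.
move=> a0 w0.
pose E := `|c + \sum_i w i| / a; have E0 : 0 <= E by rewrite divr_ge0// ltW.
pose M := \sum_i `|m i| + (1 + E).
have mM i : m i + 1 <= M.
  rewrite /M lerD// ?lerDl// (bigD1 i)//= (le_trans (ler_norm _))// lerDl.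
  exact: sumr_ge0.
exists M => [i|]; first by rewrite (lt_le_trans _ (mM i))// ltrDl.
rewrite /secular subr_gt0 ltrBrDl.
have : c + \sum_i w i / (M - m i) <= `|c + \sum_i w i|.
  apply: le_trans (ler_norm _); rewrite lerD2l.
  apply: ler_sum => i _; rewrite ler_piMr// invf_le1.
    by rewrite lerBrDl mM.
  by rewrite subr_gt0 (lt_le_trans _ (mM i))// ltrDl.
move=> /le_lt_trans; apply.
rewrite -ltr_pdivrMl// mulrC -/E /M addrA ltrDr ltr_wpDl// sumr_ge0//.
Qed.

(** After multiplication by [x - m i0] the singularity is removed and the
    value at the pole is [- w i0]. Both one-sided signs follow from this: negative
    just to the right of the pole, positive just to the left. *)
Lemma secular_near_pole a c w m i0 : {in predC1 i0, forall i, m i0 - m i != 0} ->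
  0 < w i0 ->
  \forall x \near m i0, x != m i0 -> secular a c w m x * (x - m i0) < 0.
Proof.
move=> mi0 w0.
(* the product with [x - m i0], extended continuously to the pole *)
pose phi x := (a * x - c - \sum_(i < k | i != i0) w i / (x - m i)) * (x - m i0)
               - w i0.
have idc (l : R) : x - l @[x --> m i0] --> m i0 - l.
  by apply: (@cvgB _ _ _ _ _ id (fun=> l)); [exact: cvg_id|exact: cvg_cst].
have cphi : phi x @[x --> m i0] --> phi (m i0).
  apply: cvgB; last exact: cvg_cst.
  apply: cvgM; last exact: idc.
  apply: cvgB.
    apply: cvgB; last exact: cvg_cst.
    by apply: cvgM; [exact: cvg_cst|exact: cvg_id].
  apply: cvg_sumr => i ii0; apply: cvgM; first exact: cvg_cst.
  by apply: cvgV; [exact: mi0|exact: idc].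
have phi0 : phi (m i0) < 0 by rewrite /phi subrr mulr0 sub0r oppr_lt0.
near=> x; move=> xm.
suff -> : secular a c w m x * (x - m i0) = phi x by near: x; exact: cvgr_lt cphi _ phi0.
rewrite /secular /phi (bigD1 i0)//= opprD addrCA addrC mulrDl; congr (_ + _).
by rewrite mulNr mulfVK// subr_eq0.
Unshelve. all: end_near. Qed.

Lemma in_gap_right m (i0 : 'I_k) : decreasing_tuple m ->
  \forall x \near (m i0)^'+, in_gap m i0 x.
Proof.
move=> dm; apply: filter_forall => i.
case: ltnP => ii0.
  by apply: nbhs_right_lt; apply: dm.
have mi : m i <= m i0.
  move: ii0; rewrite leq_eqVlt => /predU1P[/val_inj->//|/dm/ltW//].
near=> x; rewrite (le_lt_trans mi)//.
Unshelve. all: end_near. Qed.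

Lemma in_gap_left m (i0 : 'I_k) : decreasing_tuple m ->
  \forall x \near (m i0)^'-, in_gap m i0.+1 x.
Proof.
move=> dm; apply: filter_forall => i.
case: ltnP => ii0; last by apply: nbhs_left_gt; apply: dm.
have mi : m i0 <= m i.
  move: ii0; rewrite ltnS leq_eqVlt => /predU1P[/val_inj->//|/dm/ltW//].
near=> x; rewrite (lt_le_trans _ mi)//.
Unshelve. all: end_near. Qed.

(** Zeros exist by the intermediate value theorem between a point where the
    function is negative, near the lower end of the gap, and one where it is
    positive, near the upper end. The end of an unbounded gap is reached with the
    linear term, hence the assumption [0 < a] there. *)
Lemma secular_root a c w m j : (0 < k)%N -> decreasing_tuple m -> 0 <= a ->
  (forall i, 0 < w i) -> (j <= k)%N -> 0 < a \/ (0 < j < k)%N ->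
  exists2 x, in_gap m j x & secular a c w m x = 0.
Proof.
move=> k0 dm a0 w0 jk aj.
have sepm i0 : {in predC1 i0, forall i, m i0 - m i != 0}.
  move=> i; rewrite inE => ii0; rewrite subr_eq0.
  case: (ltngtP i i0) => [/dm|/dm|/val_inj].
  - by move=> /lt_eqF->.
  - by move=> /gt_eqF->.
  - by move/eqP; rewrite (negbTE ii0).
have [lo glo hlo] : exists2 x, in_gap m j x & secular a c w m x < 0.
  move: jk; rewrite leq_eqVlt => /predU1P[jk|jk].
    case: aj => [a_gt0|]; last by rewrite jk ltnn andbF.
    have [x xm x0] := secular_gt0_large (- c) (fun i => - m i) a_gt0
      (fun i => ltW (w0 i)).
    exists (- x); last by rewrite -oppr_gt0 -secular_opp opprK.
    by move=> i; rewrite jk ltn_ord ltrNl.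
  pose i0 := Ordinal jk.
  have near_pole : \forall x \near (m i0)^'+, in_gap m i0 x /\ secular a c w m x < 0.
    near=> x; split; first by near: x; exact: in_gap_right.
    have xm : 0 < x - m i0 by rewrite subr_gt0.
    rewrite -(pmulr_llt0 _ xm).
    have : x != m i0 by rewrite -subr_eq0 gt_eqF.
    near: x; apply: cvg_within; exact: secular_near_pole.
  have [x [gx sx]] := @filter_ex _ _ (at_right_proper_filter (m i0)) _ near_pole.
  by exists x.
have [hi ghi hhi] : exists2 x, in_gap m j x & 0 < secular a c w m x.
  case: j jk aj {lo glo hlo} => [|j] jk aj.
    case: aj => [a_gt0|//].
    have [x xm x0] := secular_gt0_large c m a_gt0 (fun i => ltW (w0 i)).
    by exists x => // i; rewrite ltn0.
  pose i0 := Ordinal jk.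
  have near_pole : \forall x \near (m i0)^'-, in_gap m i0.+1 x /\ 0 < secular a c w m x.
    near=> x; split; first by near: x; exact: in_gap_left.
    have xm : x - m i0 < 0 by rewrite subr_lt0.
    rewrite -(nmulr_llt0 _ xm).
    have : x != m i0 by rewrite -subr_eq0 lt_eqF.
    near: x; apply: cvg_within; exact: secular_near_pole.
  have [x [gx sx]] := @filter_ex _ _ (at_left_proper_filter (m i0)) _ near_pole.
  by exists x.
have lohi : lo <= hi.
  rewrite leNgt; apply/negP => /ltW hilo.
  have := secular_le c a0 (fun i => ltW (w0 i)) ghi glo hilo.
  by rewrite leNgt (lt_trans hlo hhi).
have [||x xlohi x0] := @IVT R (secular a c w m) lo hi 0 lohi.
- apply: continuous_in_subspaceT => x; rewrite inE/= in_itv/= => xlohi.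
  apply: secular_continuous => i; apply: in_gap_neq.
  exact: in_gap_between glo ghi xlohi.
- by rewrite ge_min le_max (ltW hlo) (ltW hhi) orbT.
exists x => //; move: xlohi; rewrite in_itv/=; exact: in_gap_between.
Unshelve. all: end_near. Qed.

(** Stability of the zero in a gap. Compare with the values at two fixed points
    [y] around [x]: there the limit function is nonzero, so the perturbed function
    has the same sign for parameters close to the limit, and the perturbed zero
    lies on the correct side of [y] by monotonicity. *)
Lemma secular_root_cvg (T : Type) (F : set_system T) {FF : Filter F}
    (at_ ct xt : T -> R) (wt mt : T -> 'I_k -> R) a c w m j x :
  (0 < k)%N -> 0 <= a -> (forall i, 0 < w i) ->
  in_gap m j x -> secular a c w m x = 0 ->
  at_ t @[t --> F] --> a -> ct t @[t --> F] --> c ->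
  (forall i, wt t i @[t --> F] --> w i) -> (forall i, mt t i @[t --> F] --> m i) ->
  (\forall t \near F, [/\ 0 <= at_ t, in_gap (mt t) j (xt t) &
     secular (at_ t) (ct t) (wt t) (mt t) (xt t) = 0]) ->
  xt t @[t --> F] --> x.
Proof.
move=> k0 a0 w0 gx sx ha hc hw hm hroot.
have gap_open y : in_gap m j y -> \forall t \near F, in_gap (mt t) j y.
  move=> gy; apply: filter_forall => i; have := gy i; case: ifP => _ h.
    exact: cvgr_gt (hm i) _ h.
  exact: cvgr_lt (hm i) _ h.
have wt_ge0 : \forall t \near F, forall i, 0 <= wt t i.
  apply: filter_forall => i; near=> t; apply/ltW.
  near: t; exact: cvgr_gt (hw i) _ (w0 i).
have secular_at y : in_gap m j y ->
    secular (at_ t) (ct t) (wt t) (mt t) y @[t --> F] --> secular a c w m y.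
  move=> gy; apply: secular_cvg => //; first exact: cvg_cst.
  by move=> i; exact: in_gap_neq gy.
have above y : x < y -> in_gap m j y -> \forall t \near F, xt t < y.
  move=> xy gy.
  have sy : 0 < secular a c w m y by rewrite -sx; exact: secular_lt gx gy xy.
  have cy := secular_at y gy.
  near=> t.
  have [at0 gxt sxt] : [/\ 0 <= at_ t, in_gap (mt t) j (xt t) &
     secular (at_ t) (ct t) (wt t) (mt t) (xt t) = 0] by near: t.
  rewrite ltNge; apply/negP => yx.
  suff : secular (at_ t) (ct t) (wt t) (mt t) y <= 0.
    by apply/negP; rewrite -ltNge; near: t; exact: cvgr_gt cy _ sy.
  rewrite -[leRHS]sxt; apply: secular_le gxt yx => //; near: t => //.
  exact: gap_open.
have below y : y < x -> in_gap m j y -> \forall t \near F, y < xt t.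
  move=> yx gy.
  have sy : secular a c w m y < 0 by rewrite -sx; exact: secular_lt gy gx yx.
  have cy := secular_at y gy.
  near=> t.
  have [at0 gxt sxt] : [/\ 0 <= at_ t, in_gap (mt t) j (xt t) &
     secular (at_ t) (ct t) (wt t) (mt t) (xt t) = 0] by near: t.
  rewrite ltNge; apply/negP => xy.
  suff : 0 <= secular (at_ t) (ct t) (wt t) (mt t) y.
    by apply/negP; rewrite -ltNge; near: t; exact: cvgr_lt cy _ sy.
  rewrite -[leLHS]sxt; apply: (@secular_le _ _ _ _ j) xy => //; near: t => //.
  exact: gap_open.
have gnear : \forall y \near x, in_gap m j y.
  apply: (@filter_forall _ _ _ (nbhs x)) => i; have := gx i; case: ifP => _ h.
    exact: lt_nbhsl.
  exact: lt_nbhsr.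
apply/cvgrPdist_lt => e e0.
have [d /= [d0 hd]] : exists d, d > 0 /\ forall y, `|x - y| < d -> in_gap m j y.
  by case: gnear => d /= d0 hd; exists d; split.
pose e' := Num.min e d / 2.
have e'0 : 0 < e' by rewrite /e' divr_gt0// lt_min e0.
have [e'e e'd] : e' < e /\ e' < d.
  split; rewrite /e' ltr_pdivrMr// mulr_natr mulr2n.
    by rewrite (@le_lt_trans _ _ e) ?ltrDl// ge_min lexx.
  by rewrite (@le_lt_trans _ _ d) ?ltrDl// ge_min lexx orbT.
have hlo : \forall t \near F, x - e' < xt t.
  apply: below; first by rewrite ltrBlDr ltrDl.
  by apply: hd; rewrite opprB addrC subrK gtr0_norm.
have hhi : \forall t \near F, xt t < x + e'.
  apply: above; first by rewrite ltrDl.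
  by apply: hd; rewrite opprD addNKr normrN gtr0_norm.
near=> t; rewrite distrC (lt_trans _ e'e)// ltr_norml ltrBrDr ltrBlDl addrC.
apply/andP; split; near: t; [exact: hlo|exact: hhi].
Unshelve. all: end_near. Qed.

End Secular.

(** * Location of the roots of the corner equation *)

Lemma increasing_ord_id k (f : 'I_k -> 'I_k) :
  {homo f : i j / (i < j)%N} -> f =1 id.
Proof.
move=> hf.
(* [i <= g i] for every increasing [g]; conjugating by [rev_ord] gives [>=] *)
have lower (g : 'I_k -> 'I_k) : {homo g : i j / (i < j)%N} ->
    forall i : 'I_k, (i <= g i)%N.
  move=> hg [i ik]; elim: i ik => // i IH ik.
  exact: leq_ltn_trans (IH (ltnW ik)) (hg _ _ _).
move=> i; apply/val_inj/eqP; rewrite eqn_leq; apply/andP; split; last exact: lower.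
have rev_lt (a b : 'I_k) : (a < b)%N -> (rev_ord b < rev_ord a)%N.
  by move=> ab; rewrite /= ltn_sub2l// (leq_ltn_trans ab).
have := lower (fun i => rev_ord (f (rev_ord i))) _ (rev_ord i).
rewrite rev_ordK /= leq_sub2lE// ltnS; apply=> a b ab.
exact/rev_lt/hf/rev_lt.
Qed.

(** An ordered list of at most [k] values is determined by [k] distinct ones
    that it contains: the positions of the latter form an increasing self-map of
    ['I_k]. *)
Lemma nonincreasing_enum_eq (R : realType) k (l x : 'I_k -> R) :
  nonincreasing_tuple l -> decreasing_tuple x ->
  (forall i, exists j, x i = l j) -> l =1 x.
Proof.
move=> lni xd /choice[f xf].
have fid : f =1 id.
  apply: increasing_ord_id => i j ij; rewrite ltnNge; apply/negP => /lni.
  by rewrite -!xf leNgt xd.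
by move=> i; rewrite xf fid.
Qed.

Lemma corner_equationE (R : realType) n (mu : 'I_n.+1 -> R) xi j x :
  in_gap mu j x ->
  corner_equation mu xi x <->
  secular 1 (xi ord_max) (fun i => xi (cur i)) mu x = 0.
Proof.
move=> gx; rewrite /secular mul1r; split=> [[_ ->]|/subr0_eq eqx].
  by rewrite subrr.
by split=> [i|]; [rewrite -subr_eq0; exact: in_gap_neq gx|rewrite -eqx].
Qed.

(** The zeros found in the [n + 2] gaps are distinct solutions, listed in
    decreasing order, so they exhaust [l] and match it index by index. *)
Lemma corner_roots_in_gap (R : realType) n (mu : 'I_n.+1 -> R)
    (xi l : 'I_n.+2 -> R) :
  decreasing_tuple mu -> (forall i, 0 < xi (cur i)) ->
  ordered_corner_roots mu xi l -> forall j : 'I_n.+2, in_gap mu j (l j) /\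
    secular 1 (xi ord_max) (fun i => xi (cur i)) mu (l j) = 0.
Proof.
move=> dmu xi0 [lni lroots].
have /choice[x xP] : forall j : 'I_n.+2, exists x, in_gap mu j x /\
    secular 1 (xi ord_max) (fun i => xi (cur i)) mu x = 0.
  move=> j; have [||x] := @secular_root R n.+1 1 (xi ord_max)
    (fun i => xi (cur i)) mu j isT dmu ler01 xi0; [exact: leq_ord|by left|].
  by exists x.
suff lx : l =1 x by move=> j; rewrite lx.
apply: nonincreasing_enum_eq => //.
- move=> i j ij; have i_lt : (i < n.+1)%N := leq_trans ij (leq_ord j).
  have [/(_ (Ordinal i_lt)) + _] := xP i; have [/(_ (Ordinal i_lt)) + _] := xP j.
  by rewrite /= ij ltnn; exact: lt_trans.
- move=> i; have [gx sx] := xP i.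
  by apply/lroots; apply/(corner_equationE _ gx).
Qed.

(** The substitution [x = s y] followed by multiplication by [q]: it replaces the
    coefficients by quantities that stay bounded when [q] and [s] are chosen
    according to the size of the root. *)
Lemma secular_scale (R : realType) k a c (w m : 'I_k -> R) x q s : s != 0 ->
  secular (q * a * s) (q * c) (fun i => q * w i / s) (fun i => m i / s) (x / s)
  = q * secular a c w m x.
Proof.
move=> s0; rewrite /secular mulrBr mulrBr mulr_sumr; congr (_ - _ - _).
  by field.
apply: eq_bigr => i _; rewrite -mulrBl invfM invrK.
by rewrite -[_ / s * _]mulrA [s^-1 * _]mulrC -!mulrA divff// mulr1.
Qed.

Lemma in_gap_scale (R : realType) k (m : 'I_k -> R) j x s : 0 < s ->
  in_gap m j x -> in_gap (fun i => m i / s) j (x / s).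
Proof.
by move=> s0 gx i; have := gx i; case: ifP => _; rewrite ltr_pM2r ?invr_gt0.
Qed.


(** * The limit polynomials *)

Section Polynomials.
Variable R : realType.

Lemma ordered_poly_rootsP k (p : {poly R}) (r : 'I_k -> R) : p != 0 ->
  (size p <= k.+1)%N -> decreasing_tuple r -> (forall i, root p (r i)) ->
  ordered_poly_roots p r.
Proof.
move=> p0 sp dr rr; split.
  by move=> i j; rewrite leq_eqVlt => /predU1P[/val_inj->//|/dr/ltW].
have rinj : injective r.
  by move=> i j rij; apply/val_inj; case: (ltngtP i j) => // /dr; rewrite rij ltxx.
pose rs := [seq r i | i <- enum 'I_k].
have urs : uniq rs by rewrite map_inj_uniq// enum_uniq.
have ars : all (root p) rs by apply/allP => _ /mapP[i _ ->].
have srs : size rs = k by rewrite size_map size_enum_ord.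
rewrite [LHS](@all_roots_prod_XsubC _ p rs) ?uniq_rootsE//; last first.
  apply/eqP; rewrite eqn_leq srs sp/=.
  by have := max_poly_roots p0 ars urs; rewrite srs.
by rewrite big_map big_enum.
Qed.

Lemma horner_Ppoly k (m : 'I_k -> R) x : (Ppoly m).[x] = \prod_i (x - m i).
Proof. by rewrite horner_prod; apply: eq_bigr => i _; rewrite !hornerE. Qed.

Lemma size_Ppoly k (m : 'I_k -> R) : size (Ppoly m) = k.+1.
Proof.
by rewrite /Ppoly size_prod_XsubC /index_enum -enumT size_enum_ord.
Qed.

Lemma horner_deriv_Ppoly k (m : 'I_k -> R) x : (forall i, x - m i != 0) ->
  (deriv (Ppoly m)).[x] = (Ppoly m).[x] * \sum_i (x - m i)^-1.
Proof.
move=> xm; rewrite /Ppoly; elim: (index_enum _) => [|i r IH].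
  by rewrite !big_nil derivC horner0 mulr0.
rewrite !big_cons derivM derivXsubC mul1r !hornerE IH mulrDr; congr (_ + _).
  by rewrite mulrAC divff// mul1r.
by rewrite mulrA.
Qed.

(** The equation [secular a 0 (fun=> 1/2) m x = 0] multiplied by
    [-2 * Ppoly m], for the two limit equations [a = 0] and [a = 1]. *)
Definition secular_poly k (a : R) (m : 'I_k -> R) : {poly R} :=
  deriv (Ppoly m) - ((2 * a) *: 'X) * Ppoly m.

Lemma horner_secular_poly k a (m : 'I_k -> R) x : (forall i, x - m i != 0) ->
  (secular_poly a m).[x] = - 2 * (Ppoly m).[x] * secular a 0 (fun=> 2^-1) m x.
Proof.
move=> xm; rewrite /secular_poly !hornerE horner_deriv_Ppoly// /secular subr0.
by rewrite -mulr_sumr; field.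
Qed.

Lemma root_secular_poly k a (m : 'I_k -> R) x : (forall i, x - m i != 0) ->
  root (secular_poly a m) x <-> secular a 0 (fun=> 2^-1) m x = 0.
Proof.
move=> xm; rewrite /root horner_secular_poly//; split=> [|->]; last by rewrite mulr0.
rewrite mulf_eq0 mulf_eq0 oppr_eq0 pnatr_eq0/= horner_Ppoly.
by case: eqP => [/eqP/prodf_eq0[i _]|_ /eqP//]; rewrite (negbTE (xm i)).
Qed.

(** If the polynomial vanished, the secular function would vanish at all points
    above the poles, against its strict monotonicity. *)
Lemma secular_poly_neq0 k a (m : 'I_k.+1 -> R) : 0 <= a ->
  secular_poly a m != 0.
Proof.
move=> a0; pose M := \sum_i `|m i|.
have gap t : 0 < t -> in_gap m 0 (M + t).
  move=> t0 i; rewrite ltn0 ltr_pwDr// (le_trans (ler_norm _))//.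
  by rewrite /M (bigD1 i)//= lerDl sumr_ge0.
have zero t : 0 < t -> secular_poly a m = 0 ->
    secular a 0 (fun=> 2^-1) m (M + t) = 0.
  move=> t0 p0; apply/root_secular_poly; last by rewrite p0 root0.
  by move=> i; exact: in_gap_neq (gap _ t0).
apply/eqP => p0.
suff : secular a 0 (fun=> 2^-1) m (M + 1) < secular a 0 (fun=> 2^-1) m (M + 2).
  by rewrite !zero// ltxx.
by apply: secular_lt (gap _ _) (gap _ _) _;
  rewrite ?ltrD2l ?ltr1n// => _; rewrite invr_gt0.
Qed.

Lemma gauss_deriv_horner (p : {poly R}) (x : R) :
  (deriv p - (2 *: 'X) * p).[x] =
  expR (x ^+ 2) * derive1 (fun y : R => expR (- (y ^+ 2)) * p.[y]) x.
Proof.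
have dexp : is_derive x 1 (fun y : R => expR (- (y ^+ 2)))
    (- (2 * x) * expR (- (x ^+ 2))).
  apply: trigger_derive.
  by rewrite /GRing.scale/=; ring.
have dp : is_derive x 1 (fun y => p.[y]) (deriv p).[x] by exact: is_derive_poly.
rewrite derive1E (@derive_val _ _ _ _ _ _ _ (is_deriveM dexp dp)) !hornerE.
rewrite /GRing.scale/= expRN.
have := expR_gt0 (x ^+ 2); set e := expR _ => e0.
by field; rewrite gt_eqF.
Qed.

Lemma secular_poly0 k (m : 'I_k -> R) : secular_poly 0 m = deriv (Ppoly m).
Proof. by rewrite /secular_poly mulr0 scale0r mul0r subr0. Qed.

Lemma secular_poly1 k (m : 'I_k -> R) :
  secular_poly 1 m = deriv (Ppoly m) - (2 *: 'X) * Ppoly m.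
Proof. by rewrite /secular_poly mulr1. Qed.

Lemma size_secular_poly0 k (m : 'I_k.+1 -> R) :
  (size (secular_poly 0 m) <= k.+1)%N.
Proof.
rewrite secular_poly0 -ltnS -(size_Ppoly m); apply: lt_size_deriv.
by rewrite -size_poly_eq0 size_Ppoly.
Qed.

Lemma size_secular_poly1 k (m : 'I_k.+1 -> R) :
  (size (secular_poly 1 m) <= k.+3)%N.
Proof.
rewrite (leq_trans (size_polyD _ _))// geq_max; apply/andP; split.
  by rewrite -(secular_poly0 m) (leq_trans (size_secular_poly0 m))// ltnW// ltnW.
rewrite size_polyN (leq_trans (size_polyMleq _ _))// size_Ppoly.
rewrite addnS/= (leq_add2r k.+1 _ 2).
by rewrite (leq_trans (size_scale_leq _ _))// size_polyX.
Qed.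

(** One root per admissible gap; when these roots are as many as the degree
    allows, the polynomial splits. *)
Lemma secular_gap_roots k l (f : 'I_l -> nat) a (m : 'I_k.+1 -> R) :
  decreasing_tuple m -> 0 <= a ->
  {homo f : i j / (i < j)%N} ->
  (forall i, (f i <= k.+1)%N /\ (0 < a \/ (0 < f i < k.+1)%N)) ->
  (size (secular_poly a m) <= l.+1)%N ->
  exists r : 'I_l -> R, [/\ forall i, in_gap m (f i) (r i),
    forall i, secular a 0 (fun=> 2^-1) m (r i) = 0 &
    ordered_poly_roots (secular_poly a m) r].
Proof.
move=> dm a0 hf fP sp.
have half_gt0 (i : 'I_k.+1) : 0 < 2^-1 :> R by rewrite invr_gt0.
have /choice[r rP] : forall i, exists x, in_gap m (f i) x /\
    secular a 0 (fun=> 2^-1) m x = 0.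
  move=> i; have [fk fa] := fP i.
  have [x gx sx] :=
    @secular_root R k.+1 a 0 _ m (f i) isT dm a0 half_gt0 fk fa.
  by exists x.
exists r; split=> [i|i|]; [by case: (rP i)|by case: (rP i)|].
apply: ordered_poly_rootsP => //; first exact: secular_poly_neq0.
- move=> i j ij; have fij := hf _ _ ij; have [fjk _] := fP j.
  have ik : (f i < k.+1)%N by exact: leq_trans fij fjk.
  have [/(_ (Ordinal ik)) + _] := rP i; have [/(_ (Ordinal ik)) + _] := rP j.
  by rewrite /= fij ltnn; exact: lt_trans.
- move=> i; have [gr sr] := rP i; apply/root_secular_poly => // i'.
  exact: in_gap_neq gr.
Qed.

Lemma ordered_poly_roots_mem k (p : {poly R}) (r : 'I_k -> R) x : p != 0 ->
  ordered_poly_roots p r -> root p x -> exists i, x = r i.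
Proof.
move=> p0 [_ pE]; rewrite /root pE hornerZ horner_Ppoly mulf_eq0 lead_coef_eq0.
rewrite (negbTE p0)/= => /prodf_eq0[i _]; rewrite subr_eq0 => /eqP ->.
by exists i.
Qed.

End Polynomials.

(** * Concentration of the halved chi-squared law *)

Section HalfChi2.
Variable R : realType.
Notation mu := (@lebesgue_measure R).

Lemma continuous_powR_itv (p N : R) : 0 < p -> 0 < N ->
  {within `[0, N], continuous (fun x : R => x `^ p)}.
Proof.
move=> p0 N0.
have cpos (x : R) : 0 < x -> {for x, continuous (fun x : R => x `^ p)}.
  move=> x0; apply/differentiable_continuous/derivable1_diffP/derivable_powR.
  by rewrite in_itv/= x0.
apply/continuous_within_itvP => //; split.
- by move=> x; rewrite in_itv/= => /andP[x0 _]; exact: cpos.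
- by rewrite powR0 ?gt_eqF//; exact: powR_cvg0.
- exact/cvg_at_left_filter/cpos.
Qed.

Lemma continuous_expRN : continuous (fun x : R => expR (- x)).
Proof.
move=> x; apply: (@continuous_comp _ _ _ -%R expR); first exact: opp_continuous.
exact: continuous_expR.
Qed.

Lemma gamma_fun_ge0 (s : R) : 0 <= gamma_fun s.
Proof.
apply: Rintegral_ge0 => x _.
by rewrite mulr_ge0 ?powR_ge0 ?expR_ge0.
Qed.

Lemma half_chi2_pdf_ge0 (b x : R) : 0 <= half_chi2_pdf b x.
Proof.
rewrite /half_chi2_pdf; case: ifP => // _.
by rewrite !mulr_ge0 ?invr_ge0 ?gamma_fun_ge0 ?powR_ge0 ?expR_ge0.
Qed.

(** Closed form valid up to the endpoint [0], where both sides vanish because the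
    exponent [b / 2 - 1] is positive; it makes the density continuous on
    [[0, N]]. *)
Lemma half_chi2_pdfE (b x : R) : 2 < b -> 0 <= x ->
  half_chi2_pdf b x = (gamma_fun (b / 2))^-1 * x `^ (b / 2 - 1) * expR (- x).
Proof.
move=> b2; rewrite le_eqVlt /half_chi2_pdf => /predU1P[<-|->//].
rewrite ltxx powR0 ?mulr0 ?mul0r// subr_eq0 gt_eqF//; lra.
Qed.

Lemma half_chi2_pdf_continuous (b N : R) : 2 < b -> 0 < N ->
  {within `[0, N], continuous (half_chi2_pdf b)}.
Proof.
move=> b2 N0; apply/subspace_continuousP => x xN.
have xge0 : 0 <= x by move: xN; rewrite /= in_itv/= => /andP[].
rewrite /from_subspace/= half_chi2_pdfE//.
apply: (@cvg_trans _ ((fun x => (gamma_fun (b / 2))^-1 * x `^ (b / 2 - 1) * expR (- x))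
    @ within `[0, N] (nbhs x))).
  apply: near_eq_cvg; near=> y; rewrite half_chi2_pdfE//.
  suff : `[0, N]%classic y by rewrite /= in_itv/= => /andP[].
  by near: y; exact: withinT.
apply: cvgM.
  apply: cvgM; first exact: cvg_cst.
  have p0 : 0 < b / 2 - 1 by lra.
  by have /subspace_continuousP := continuous_powR_itv p0 N0; apply.
apply: cvg_within_filter; exact: continuous_expRN.
Unshelve. all: end_near. Qed.

(** A primitive of [((x - s)^2 - s)] times the density of normalising constant
    [Z]. *)
Definition half_chi2_antideriv (s Z x : R) := - (Z * (x - s + 1) * x `^ s * expR (- x)).

Lemma is_derive_half_chi2_antideriv (s Z x : R) : 0 < s -> 0 < x ->
  is_derive x 1 (half_chi2_antideriv s Z)
    (((x - s) ^+ 2 - s) * (Z * x `^ (s - 1) * expR (- x))).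
Proof.
move=> s0 x0; have dp := is_derive1_powR s x0.
rewrite /half_chi2_antideriv; apply: trigger_derive.
rewrite /GRing.scale/= -(mulr_powRB1 (ltW x0) s0); ring.
Qed.

Lemma centered_square_pdf_continuous (b N : R) : 2 < b -> 0 < N ->
  {within `[0, N],
   continuous (fun x => ((x - b / 2) ^+ 2 - b / 2) * half_chi2_pdf b x)}.
Proof.
move=> b2 N0; set s := b / 2.
apply/subspace_continuousP => x xN; rewrite /from_subspace/=; apply: cvgM.
  apply: cvg_within_filter; apply: cvgB; last exact: cvg_cst.
  have idc : y - s @[y --> x] --> x - s.
    by apply: (@cvgB _ _ _ _ _ id (fun=> s)); [exact: cvg_id|exact: cvg_cst].
  exact: (cvgM idc idc).
by have /subspace_continuousP := half_chi2_pdf_continuous b2 N0; apply.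
Qed.

Lemma half_chi2_FTC (b N : R) : 2 < b -> 0 < N ->
  (\int[mu]_(x in `[0%R, N]) (((x - b / 2) ^+ 2 - b / 2) * half_chi2_pdf b x)%R%:E =
   (half_chi2_antideriv (b / 2) (gamma_fun (b / 2))^-1 N)%:E)%E.
Proof.
move=> b2 N0; set s := b / 2; set Z := _^-1.
have s0 : 0 < s by rewrite /s; lra.
have F0 : half_chi2_antideriv s Z 0 = 0.
  by rewrite /half_chi2_antideriv powR0 ?gt_eqF// mulr0 mul0r oppr0.
have cF : {within `[0, N], continuous (half_chi2_antideriv s Z)}.
  apply/subspace_continuousP => x xN.
  rewrite /from_subspace/= /half_chi2_antideriv; apply: cvgN; apply: cvgM.
    apply: cvgM.
      apply: cvg_within_filter; apply: cvgM; first exact: cvg_cst.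
      apply: cvgD; last exact: cvg_cst.
      by apply: cvgB; [exact: cvg_id|exact: cvg_cst].
    by have /subspace_continuousP := continuous_powR_itv s0 N0; apply.
  apply: cvg_within_filter; exact: continuous_expRN.
rewrite (@continuous_FTC2 _ _ (half_chi2_antideriv s Z))//.
- by rewrite F0 sube0.
- exact: centered_square_pdf_continuous.
- have [_ cF0 cFN] := (continuous_within_itvP _ N0).1 cF.
  split; [move=> x; rewrite in_itv/= => /andP[x0 _]|exact: cF0|exact: cFN].
  by have [] := is_derive_half_chi2_antideriv Z s0 x0.
- move=> x; rewrite in_itv/= => /andP[x0 _].
  have [_ dF] := is_derive_half_chi2_antideriv Z s0 x0.
  by rewrite derive1E dF half_chi2_pdfE// ltW.
Qed.

(** Truncating at [N] keeps the primitive nonpositive at the upper end, so the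
    truncated second moment about [b / 2] is at most [b / 2] times the truncated
    mass. *)
Lemma half_chi2_truncated_variance (b N : R) : 2 < b -> 0 < N -> b / 2 - 1 <= N ->
  (\int[mu]_(x in `[0%R, N]) (half_chi2_pdf b x)%:E <= 1 ->
   \int[mu]_(x in `[0%R, N]) ((x - b / 2) ^+ 2 * half_chi2_pdf b x)%R%:E
   <= (b / 2)%:E)%E.
Proof.
move=> b2 N0 bN pdf_le1; set s := b / 2 in bN *.
have s0 : 0 < s by rewrite /s; lra.
have int0 : mu.-integrable `[0, N] (EFin \o half_chi2_pdf b).
  apply: continuous_compact_integrable; first exact: segment_compact.
  exact: half_chi2_pdf_continuous.
have int1 : mu.-integrable `[0, N]
    (EFin \o (fun x => ((x - s) ^+ 2 - s) * half_chi2_pdf b x)).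
  apply: continuous_compact_integrable; first exact: segment_compact.
  exact: centered_square_pdf_continuous.
under eq_integral => x _.
  rewrite (_ : (x - s) ^+ 2 * half_chi2_pdf b x =
    ((x - s) ^+ 2 - s) * half_chi2_pdf b x + s * half_chi2_pdf b x); last by ring.
  rewrite EFinD [X in (_ + X)%E]EFinM.
  over.
rewrite integralD//; last exact: integrableZl.
rewrite half_chi2_FTC// integralZl//.
rewrite -[leRHS]adde0 [leRHS]addeC leeD//.
  rewrite lee_fin oppr_le0 !mulr_ge0 ?expR_ge0 ?powR_ge0 ?invr_ge0 ?gamma_fun_ge0//.
  by rewrite -/s; lra.
by rewrite -[leRHS]mule1 lee_pmul2l.
Qed.

Lemma half_chi2_truncated_chebyshev (b N c : R) (A : set R) : 2 < b -> 0 < N ->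
  b / 2 - 1 <= N -> 0 < c -> measurable A ->
  (forall x, A x -> c <= (x - b / 2) ^+ 2) ->
  (\int[mu]_(x in `[0%R, N]) (half_chi2_pdf b x)%:E <= 1 ->
   half_chi2_prob b (A `&` `[0%R, N]) <= (c^-1 * (b / 2))%:E)%E.
Proof.
move=> b2 N0 bN c0 mA Ac pdf_le1.
have mpdf : measurable_fun `[0, N] (half_chi2_pdf b).
  by apply: subspace_continuous_measurable_fun => //; exact: half_chi2_pdf_continuous.
have msq : measurable_fun `[0, N]
    (fun x => (c^-1 * ((x - b / 2) ^+ 2 * half_chi2_pdf b x))%:E).
  apply/measurable_EFinP; apply: measurable_funM => //.
  apply: measurable_funM => //.
  by apply: measurable_funX; apply: measurable_funB => //.
have sq_ge0 x : (0 <= (c^-1 * ((x - b / 2) ^+ 2 * half_chi2_pdf b x))%:E)%E.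
  rewrite lee_fin; apply: mulr_ge0; first by rewrite invr_ge0 ltW.
  by apply: mulr_ge0; rewrite ?sqr_ge0 ?half_chi2_pdf_ge0.
have mAN : measurable (A `&` `[0, N]) by exact: measurableI.
apply: (@le_trans _ _ (\int[mu]_(x in A `&` `[0%R, N])
    (c^-1 * ((x - b / 2) ^+ 2 * half_chi2_pdf b x))%:E)%E).
  apply: ge0_le_integral => //.
  - by move=> x _; rewrite lee_fin half_chi2_pdf_ge0.
  - by apply/measurable_EFinP; apply: measurable_funS mpdf.
  - by apply: measurable_funS msq.
  - move=> x [Ax _]; rewrite lee_fin mulrA ler_peMl ?half_chi2_pdf_ge0//.
    by rewrite mulrC ler_pdivlMr// mul1r Ac.
apply: (@le_trans _ _ (\int[mu]_(x in `[0%R, N])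
    (c^-1 * ((x - b / 2) ^+ 2 * half_chi2_pdf b x))%:E)%E).
  by apply: ge0_subset_integral.
under eq_integral do rewrite EFinM.
rewrite ge0_integralZl_EFin//.
- by rewrite EFinM lee_pmul2l ?lte_fin ?invr_gt0// half_chi2_truncated_variance.
- by move=> x _; rewrite lee_fin mulr_ge0 ?sqr_ge0 ?half_chi2_pdf_ge0.
- apply/measurable_EFinP; apply: measurable_funM => //.
  by apply: measurable_funX; apply: measurable_funB => //.
- by rewrite invr_ge0 ltW.
Qed.

(** Chebyshev's inequality; the truncation is removed by continuity from below
    of the measure, and the negative half-line has measure zero. *)
Lemma half_chi2_chebyshev (nu : probability R R) (b c : R)
    (A : set R) : 2 < b -> 0 < c ->
  (forall B, measurable B -> nu B = half_chi2_prob b B) -> measurable A ->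
  (forall x, A x -> c <= (x - b / 2) ^+ 2) ->
  (nu A <= (c^-1 * (b / 2))%:E)%E.
Proof.
move=> b2 c0 nuE mA Ac.
have nu_neg : nu `]-oo, 0[%classic = 0.
  rewrite nuE// /half_chi2_prob integral0_eq// => x; rewrite /= in_itv/= => x0.
  by rewrite /half_chi2_pdf ltNge ltW.
pose F n := A `&` `[0, n%:R]%classic.
have mF n : measurable (F n) by exact: measurableI.
have mUF : measurable (\bigcup_n F n) by exact: bigcupT_measurable.
have A_sub : A `<=` `]-oo, 0[%classic `|` \bigcup_n F n.
  move=> x Ax; have [x0|x0] := ltP x 0; [left|right].
    by rewrite /= in_itv.
  exists (Num.truncn x).+1 => //; split => //=.
  by rewrite in_itv/= x0 ltW// truncnS_gt.
apply: (@le_trans _ _ (nu (\bigcup_n F n))).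
  apply: (@le_trans _ _ (nu (`]-oo, 0[%classic `|` \bigcup_n F n))).
    apply: le_measure => //; rewrite inE//.
    exact: measurableU.
  apply: (le_trans (measureU2 _ _ _)) => //.
  by rewrite [X in (X + _)%E]nu_neg add0e.
have cvgF : (nu \o F) n @[n --> \oo] --> nu (\bigcup_n F n).
  apply: nondecreasing_cvg_mu => //.
  move=> m n mn; apply/subsetPset; apply: setIS => x.
  rewrite /= !in_itv/= => /andP[-> /le_trans]; apply.
  by rewrite ler_nat.
apply: cvge_le cvgF; near=> n; rewrite /= nuE; last exact: mF.
have n0 : 0 < n%:R :> R by rewrite ltr0n; near: n; exact: nbhs_infty_gt.
apply: half_chi2_truncated_chebyshev => //.
  by near: n; exact: nbhs_infty_ger.
have <- : nu `[0, n%:R]%classic = (\int[mu]_(x in `[0%R, n%:R]) (half_chi2_pdf b x)%:E)%E.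
  by rewrite nuE.
exact: probability_le1.
Unshelve. all: end_near. Qed.

End HalfChi2.

(** * Convergence in probability as convergence along a filter *)

Section AsymptoticallySure.
Variables (R : realType) (d : R -> measure_display).
Variables (T : forall b : R, measurableType (d b)).
Variable P : forall b : R, probability (T b) R.

(** Convergence in probability of random variables living on different spaces
    is convergence along this filter (see [tuple_cvg_in_probP] and
    [prob_cvg0_asymptotically_sure]). Covering the exceptional set by a measurable
    one spares measurability conditions on [S]. *)
Definition asymptotically_sure : set_system {b : R & T b} := fun S =>
  exists B : forall b, set (T b),
    [/\ forall b, measurable (B b),
        P b (B b) @[b --> +oo%R] --> 0%E &
        \forall b \near +oo%R, forall w, ~ S (existT _ b w) -> B b w].

Let probability_set0_cvg : P b set0 @[b --> +oo%R] --> 0%E.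
Proof.
rewrite (_ : (fun b => P b set0) = cst 0%E); first exact: cvg_cst.
by apply/funext => b; rewrite measure0.
Qed.

#[global] Instance asymptotically_sure_filter : Filter asymptotically_sure.
Proof.
split.
- exists (fun=> set0); split=> //; last by near=> b; move=> w; case.
- move=> S1 S2 [B1 [mB1 P1 h1]] [B2 [mB2 P2 h2]].
  exists (fun b => B1 b `|` B2 b); split.
  + by move=> b; exact: measurableU.
  + apply: (@squeeze_cvge _ _ _ _ (cst 0%E) _
      (fun b => P b (B1 b) + P b (B2 b))%E); last 2 first.
    * exact: cvg_cst.
    * by rewrite -[X in _ --> X]adde0; apply: cvgeD.
    by near=> b; rewrite measure_ge0/= measureU2.
  + near=> b; move=> w /not_andP[nS|nS]; [left|right]; move: w nS; near: b.
      exact: h1.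
    exact: h2.
- move=> S1 S2 S12 [B [mB PB h]]; exists B; split=> //.
  near=> b; move=> w nS; have : forall w : T b, ~ S1 (existT _ b w) -> B b w.
    by near: b.
  by apply => /S12.
Unshelve. all: end_near. Qed.

Lemma asymptotically_sure_notin (B : forall b, set (T b)) :
  (forall b, measurable (B b)) -> P b (B b) @[b --> +oo%R] --> 0%E ->
  \forall t \near asymptotically_sure, ~ B (tag t) (tagged t).
Proof.
move=> mB PB; exists B; split=> //.
by near=> b; move=> w /= /contrapT.
Unshelve. all: end_near. Qed.

Lemma asymptotically_sure_tag (Q : set R) : (\forall b \near +oo%R, Q b) ->
  \forall t \near asymptotically_sure, Q (tag t).
Proof.
move=> hQ; exists (fun=> set0); split=> //.
near=> b; move=> w nQ; exfalso; apply: nQ => /=; near: b; exact: hQ.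
Unshelve. all: end_near. Qed.

Lemma asymptotically_sure_cvg_tag (f : R -> R) (l : R) :
  f b @[b --> +oo%R] --> l -> f (tag t) @[t --> asymptotically_sure] --> l.
Proof.
by move=> fl; apply: (cvg_comp _ _ _ fl) => Q; exact: asymptotically_sure_tag.
Qed.

Lemma asymptotically_sure_ae (Q : forall b, set (T b)) :
  (forall b, 0 < b -> {ae P b, forall w, Q b w}) ->
  \forall t \near asymptotically_sure, Q (tag t) (tagged t).
Proof.
move=> aeQ.
have exB b : exists B : set (T b), [/\ measurable B, P b B = 0%E &
    0 < b -> forall w, ~ Q b w -> B w].
  have [b0|b0] := ltP 0 b; last by exists set0; split=> //; rewrite measure0.
  by have [B [mB PB QB]] := aeQ b b0; exists B.
exists (fun b => sval (cid (exB b))); split.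
- by move=> b; case: (svalP (cid (exB b))).
- rewrite (_ : (fun b => P b (sval (cid (exB b)))) = cst 0%E); first exact: cvg_cst.
  by apply/funext => b; case: (svalP (cid (exB b))).
- near=> b; case: (svalP (cid (exB b))) => _ _; apply.
  by near: b; exact: nbhs_pinfty_gt.
Unshelve. all: end_near. Qed.

Lemma asymptotically_sure_cvg0 (E : forall b, set (T b)) :
  (forall b, measurable (E b)) ->
  (\forall t \near asymptotically_sure, ~ E (tag t) (tagged t)) ->
  P b (E b) @[b --> +oo%R] --> 0%E.
Proof.
move=> mE [B [mB PB h]].
apply: (@squeeze_cvge _ _ _ _ (cst 0%E) _ (fun b => P b (B b))) PB.
  near=> b; rewrite measure_ge0/= le_measure ?inE// => w Ew.
  have : forall w : T b, ~ ~ E b w -> B b w by near: b; exact: h.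
  by apply; apply.
exact: cvg_cst.
Unshelve. all: end_near. Qed.

Lemma tuple_cvg_in_probP k (X : forall b, 'I_k -> T b -> R) (c : 'I_k -> R) :
  (forall b i, measurable_fun setT (X b i)) ->
  (forall i, X (tag t) i (tagged t) @[t --> asymptotically_sure] --> c i) ->
  tuple_cvg_in_prob P X c.
Proof.
move=> mX cX e e0; apply: asymptotically_sure_cvg0.
  move=> b.
  have -> : [set w | exists i, e < `|X b i w - c i|] =
      \bigcup_(i in [set: 'I_k]) [set w | e < `|X b i w - c i|].
    by apply/seteqP; split=> w /= [i]; [exists i|exists i].
  apply: fin_bigcup_measurable => // i _.
  have -> : [set w | e < `|X b i w - c i|] =
      (fun w => `|X b i w - c i|) @^-1` `]e, +oo[%classic.
    by apply/seteqP; split=> w /=; rewrite in_itv/= andbT.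
  rewrite -[X in measurable X]setTI.
  have mf : measurable_fun setT (fun w => `|X b i w - c i|).
    by apply: measurableT_comp => //; exact: measurable_funB.
  exact: mf.
have : \forall t \near asymptotically_sure,
    forall i, `|c i - X (tag t) i (tagged t)| < e.
  apply: filter_forall => i; exact: (cvgrPdist_lt _ _).1 (cX i) _ e0.
apply: filterS => t h [i]; rewrite distrC; apply/negP; rewrite -leNgt ltW//.
Qed.

Lemma cvg_in_probP (X : forall b, T b -> R) (c : R) :
  (forall b, measurable_fun setT (X b)) ->
  X (tag t) (tagged t) @[t --> asymptotically_sure] --> c ->
  cvg_in_prob P X c.
Proof.
move=> mX cX e e0.
have := @tuple_cvg_in_probP 1 (fun b _ => X b) (fun=> c) (fun b _ => mX b)
  (fun=> cX) e e0.
have E b : [set w | exists _ : 'I_1, e < `|X b w - c|] = [set w | e < `|X b w - c|].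
  by apply/seteqP; split=> w /=; [case|exists ord0].
rewrite (_ : (fun b => _) = fun b => P b [set w | e < `|X b w - c|])//.
by apply/funext => b; rewrite E.
Qed.

Lemma prob_cvg0_asymptotically_sure (X : forall b, T b -> R) (c : R) :
  (forall b, measurable_fun setT (X b)) ->
  (forall e, 0 < e -> P b [set w | e <= `|X b w - c|] @[b --> +oo%R] --> 0%E) ->
  X (tag t) (tagged t) @[t --> asymptotically_sure] --> c.
Proof.
move=> mX PX; apply/cvgrPdist_lt => e e0.
have mE b : measurable [set w | e <= `|X b w - c|].
  have -> : [set w | e <= `|X b w - c|] =
      (fun w => `|X b w - c|) @^-1` `[e, +oo[%classic.
    by apply/seteqP; split=> w /=; rewrite in_itv/= andbT.
  rewrite -[X in measurable X]setTI.
  have mf : measurable_fun setT (fun w => `|X b w - c|).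
    by apply: measurableT_comp => //; exact: measurable_funB.
  exact: mf.
have hE := asymptotically_sure_notin mE (PX e e0).
near=> t; rewrite distrC ltNge; apply/negP; near: t; exact: hE.
Unshelve. all: end_near. Qed.

End AsymptoticallySure.

(** * Convergence of the rescaled roots *)

Lemma cvg_inv_pinfty (R : realType) : x^-1 @[x --> +oo%R] --> (0 : R).
Proof.
apply/gtr0_cvgV0; first exact: nbhs_pinfty_gt.
exact: cvg_id.
Qed.

Lemma cvg_sqrt_pinfty (R : realType) :
  Num.sqrt x @[x --> +oo%R] --> (+oo%R : set_system R).
Proof.
apply/cvgryPge => A; near=> x.
have [A0|A0] := leP A 0; first exact: le_trans (sqrtr_ge0 _).
rewrite -(ger0_norm (ltW A0)) -sqrtr_sqr ler_wsqrtr//.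
Unshelve. all: end_near. Qed.

Lemma measurable_tail (R : realType) (M : R) : measurable [set x : R | M <= `|x|].
Proof.
rewrite (_ : [set x | _] = Num.norm @^-1` `[M, +oo[%classic).
  by rewrite -[X in measurable X]setTI; apply: normr_measurable.
by apply/seteqP; split=> w /=; rewrite in_itv/= andbT.
Qed.

(** A probability measure on the line is tight. Applied to the law of the
    Gaussian variable, which is the same for all parameters, this makes the
    variable negligible at every scale that tends to infinity. *)
Lemma prob_tail_cvg0 (R : realType) (nu : probability R R) :
  nu [set x : R | M <= `|x|] @[M --> +oo%R] --> 0%E.
Proof.
pose F n := [set x : R | n%:R <= `|x|].
have mF n : measurable (F n) by exact: measurable_tail.
have capF : \bigcap_n F n = set0.
  apply/seteqP; split=> // x /(_ (Num.truncn `|x|).+1 I).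
  by rewrite /F/= leNgt truncnS_gt.
have cvgF : nu (F n) @[n --> \oo] --> 0%E.
  have <- : nu (\bigcap_n F n) = 0%E by rewrite capF measure0.
  apply: nonincreasing_cvg_mu => //.
  - by apply: (@le_lt_trans _ _ 1%E); [apply: probability_le1; exact: mF|rewrite ltry].
  - by rewrite capF.
  - move=> m n mn; apply/subsetPset => x /=; apply: le_trans.
    by rewrite ler_nat.
have cvg_truncn : Num.truncn M @[M --> (+oo%R : set_system R)] --> \oo.
  apply/cvgnyPge => A; near=> M.
  rewrite truncn_ge_nat; last by near: M; exact: nbhs_pinfty_ge.
  by near: M; exact: nbhs_pinfty_ge.
have := cvg_comp _ _ cvg_truncn cvgF.
apply: (@squeeze_cvge _ _ _ _ (cst 0%E)); last exact: cvg_cst.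
near=> M; rewrite measure_ge0/= le_measure ?inE//; first exact: measurable_tail.
move=> x /=; apply: le_trans; rewrite truncn_le//.
Unshelve. all: end_near. Qed.

Section Limit.
Variables (R : realType) (n : nat) (aN : R).
Variables (d : R -> measure_display) (T : forall b : R, measurableType (d b)).
Variable P : forall b : R, probability (T b) R.
Variable xi : forall b : R, 'I_n.+2 -> {RV (P b) >-> R}.
Variable lambda : forall b : R, ('I_n.+1 -> R) -> 'I_n.+2 -> {RV (P b) >-> R}.
Hypothesis xi_chi2 : forall b : R, 0 < b -> forall (i : 'I_n.+1) (A : set R),
  measurable A -> distribution (P b) (xi b (cur i)) A = half_chi2_prob b A.
Hypothesis xi_normal : forall b : R, 0 < b -> forall A : set R,
  measurable A -> distribution (P b) (xi b ord_max) A = normal_prob aN 1 A.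
Hypothesis lambda_roots : forall b : R, 0 < b -> forall mu : 'I_n.+1 -> R,
  decreasing_tuple mu ->
  {ae P b, forall w, ordered_corner_roots mu
     (fun i => xi b i w) (fun i => lambda b mu i w)}.

Let AS := asymptotically_sure P.

(** Chebyshev's inequality bounds the probability of a deviation [e] by
    [(e b)^-2 (b / 2) = (2 e^2 b)^-1]. *)
Lemma xi_chi2_cvg i : xi (tag t) (cur i) (tagged t) / tag t @[t --> AS] --> (2^-1 : R).
Proof.
apply: (@prob_cvg0_asymptotically_sure _ _ _ P (fun b w => xi b (cur i) w / b)).
  by move=> b; apply: measurable_funM.
move=> e e0.
apply: (@squeeze_cvge _ _ _ _ (cst 0%E) _ (fun b => ((2 * e ^+ 2)^-1 * b^-1)%:E)).
- near=> b; rewrite measure_ge0/=.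
  have b2 : 2 < b by near: b; exact: nbhs_pinfty_gt.
  have b0 : 0 < b by lra.
  have -> : ((2 * e ^+ 2)^-1 * b^-1) = ((e * b) ^+ 2)^-1 * (b / 2).
    by field; rewrite !gt_eqF.
  pose A := [set x : R | e <= `|x / b - 2^-1|].
  change (distribution (P b) (xi b (cur i)) A <=
    (((e * b) ^+ 2)^-1 * (b / 2))%R%:E)%E.
  apply: (@half_chi2_chebyshev R (distribution (P b) (xi b (cur i))) b _ A) => //.
  + by rewrite exprn_gt0// mulr_gt0.
  + by move=> B mB; exact: xi_chi2.
  + rewrite /A (_ : [set x | _] = (fun x => x / b - 2^-1) @^-1` [set x | e <= `|x|])//.
    rewrite -[X in measurable X]setTI.
    have mf : measurable_fun setT (fun x : R => x / b - 2^-1).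
      by apply: measurable_funB => //; apply: measurable_funM.
    by apply: mf => //; exact: measurable_tail.
  + move=> x Ax; rewrite -[leRHS]real_normK ?num_real//.
    rewrite ler_sqr ?nnegrE ?mulr_ge0 ?(ltW e0) ?(ltW b0)//.
    have -> : x - b / 2 = (x / b - 2^-1) * b by field; rewrite gt_eqF.
    by rewrite normrM (gtr0_norm b0) ler_pM2r.
- exact: cvg_cst.
- apply: cvg_EFin; first exact: nearW.
  rewrite -[X in _ --> X](mulr0 (2 * e ^+ 2)^-1).
  by apply: cvgM; [exact: cvg_cst|exact: cvg_inv_pinfty].
Unshelve. all: end_near. Qed.

Lemma xi_normal_cvg :
  xi (tag t) ord_max (tagged t) / Num.sqrt (tag t) @[t --> AS] --> (0 : R).
Proof.
apply: (@prob_cvg0_asymptotically_sure _ _ _ P (fun b w => xi b ord_max w / Num.sqrt b)).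
  by move=> b; apply: measurable_funM.
move=> e e0.
pose nu : probability R R := distribution (P 1) (xi 1 ord_max).
pose tail M := nu [set x : R | M <= `|x|].
have : tail (e * Num.sqrt b) @[b --> +oo%R] --> 0%E.
  have e_cvg : e * Num.sqrt b @[b --> +oo%R] --> (+oo%R : set_system R).
    have /cvgryPge sqrt_ge := @cvg_sqrt_pinfty R.
    apply/cvgryPge => A; near=> b; rewrite -ler_pdivrMl//; near: b.
    exact: sqrt_ge.
  exact: (cvg_comp _ _ e_cvg (prob_tail_cvg0 nu)).
apply: cvg_trans; apply: near_eq_cvg; near=> b.
have b0 : 0 < b by near: b; exact: nbhs_pinfty_gt.
have sb0 : 0 < Num.sqrt b by rewrite sqrtr_gt0.
have -> M : tail M = normal_prob aN 1 [set x : R | M <= `|x|].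
  exact: (xi_normal ltr01 (measurable_tail M)).
rewrite -(xi_normal b0); last exact: measurable_tail.
rewrite /distribution /pushforward; congr (P b _).
apply/seteqP; split=> w /=; rewrite subr0 normrM normfV (gtr0_norm sb0).
  by rewrite ler_pdivlMr.
by rewrite ler_pdivlMr.
Unshelve. all: end_near. Qed.

(** The common source of the three limits. The scale [s b] is the order of
    magnitude of the root considered; [alpha ^+ 2] is the limit of the leading
    coefficient [(s b)^2 / b] of the rescaled equation. *)
Lemma scaled_root_cvg (mu : R -> 'I_n.+1 -> R) (s : R -> R) (alpha : R)
    (m : 'I_n.+1 -> R) (j : 'I_n.+2) (r : R) :
  (forall b, 0 < b -> decreasing_tuple (mu b)) -> (forall b, 0 < b -> 0 < s b) ->
  s b / Num.sqrt b @[b --> +oo%R] --> alpha ->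
  (forall i, mu b i / s b @[b --> +oo%R] --> m i) ->
  in_gap m j r -> secular (alpha ^+ 2) 0 (fun=> 2^-1) m r = 0 ->
  lambda (tag t) (mu (tag t)) j (tagged t) / s (tag t) @[t --> AS] --> r.
Proof.
move=> dmu s0 salpha mum gr sr.
pose ratio (t : {b & T b}) := s (tag t) / Num.sqrt (tag t).
have ratio_cvg : ratio t @[t --> AS] --> alpha.
  exact: (@asymptotically_sure_cvg_tag _ _ _ P (fun b => s b / Num.sqrt b)).
have xi_pos : \forall t \near AS, forall i, 0 < xi (tag t) (cur i) (tagged t).
  apply: filter_forall => i; near=> t.
  have t0 : 0 < tag t.
    by near: t; apply: (@asymptotically_sure_tag _ _ _ P [set b | 0 < b]);
      exact: nbhs_pinfty_gt.
  have : 0 < xi (tag t) (cur i) (tagged t) / tag t.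
    by near: t; apply: cvgr_gt (xi_chi2_cvg i) _ _; rewrite invr_gt0.
  by rewrite pmulr_lgt0 ?invr_gt0.
have roots : \forall t \near AS, ordered_corner_roots (mu (tag t))
    (fun i => xi (tag t) i (tagged t))
    (fun i => lambda (tag t) (mu (tag t)) i (tagged t)).
  apply: (@asymptotically_sure_ae _ _ _ P (fun b w => ordered_corner_roots (mu b)
    (fun i => xi b i w) (fun i => lambda b (mu b) i w))) => b b0.
  by apply: lambda_roots => //; exact: dmu.
apply: (@secular_root_cvg R n.+1 _ AS _ (fun t => ratio t ^+ 2)
  (fun t => ratio t * (xi (tag t) ord_max (tagged t) / Num.sqrt (tag t))) _
  (fun t i => xi (tag t) (cur i) (tagged t) / tag t)
  (fun t i => mu (tag t) i / s (tag t)) (alpha ^+ 2) 0 (fun=> 2^-1) m j r) => //.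
- by rewrite sqr_ge0.
- by rewrite expr2; under eq_cvg do rewrite expr2; exact: cvgM.
- by rewrite -[X in _ --> X](mulr0 alpha); apply: cvgM => //; exact: xi_normal_cvg.
- exact: xi_chi2_cvg.
- by move=> i; exact: (@asymptotically_sure_cvg_tag _ _ _ P (fun b => mu b i / s b)).
- near=> t.
  have t0 : 0 < tag t.
    by near: t; apply: (@asymptotically_sure_tag _ _ _ P [set b | 0 < b]);
      exact: nbhs_pinfty_gt.
  have st0 := s0 _ t0; have dt := dmu _ t0.
  have xt : forall i, 0 < xi (tag t) (cur i) (tagged t) by near: t.
  have rt : ordered_corner_roots (mu (tag t))
    (fun i => xi (tag t) i (tagged t))
    (fun i => lambda (tag t) (mu (tag t)) i (tagged t)).
    by near: t.
  have [gl sl] := corner_roots_in_gap dt xt rt j.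
  split; [exact: sqr_ge0|exact: in_gap_scale|].
  have sqt0 : 0 < Num.sqrt (tag t) by rewrite sqrtr_gt0.
  have sqtV : (tag t)^-1 = (Num.sqrt (tag t))^-1 ^+ 2.
    by rewrite exprVn sqr_sqrtr// ltW.
  have := secular_scale 1 (xi (tag t) ord_max (tagged t))
    (fun i => xi (tag t) (cur i) (tagged t)) (mu (tag t))
    (lambda (tag t) (mu (tag t)) j (tagged t)) (s (tag t) / tag t) (lt0r_neq0 st0).
  rewrite sl mulr0 => <-; congr (secular _ _ _ _ _).
  + by rewrite /ratio sqtV; ring.
  + by rewrite /ratio sqtV; ring.
  + by apply/funext => i; field; rewrite !lt0r_neq0.
Unshelve. all: end_near. Qed.

End Limit.

(** * The theorem *)

(* N = n.+2 *)
Theorem proposition6p1 (R : realType) (n : nat) (aN : R)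
    (d : R -> measure_display) (T : forall b : R, measurableType (d b))
    (P : forall b : R, probability (T b) R)
    (xi : forall b : R, 'I_n.+2 -> {RV (P b) >-> R})
    (lambda : forall b : R, ('I_n.+1 -> R) -> 'I_n.+2 -> {RV (P b) >-> R})
    (xi_indep : forall b : R, 0 < b -> mutually_independent (xi b))
    (xi_chi2 : forall b : R, 0 < b -> forall (i : 'I_n.+1) (A : set R),
      measurable A ->
      distribution (P b) (xi b (cur i)) A = half_chi2_prob b A)
    (xi_normal : forall b : R, 0 < b -> forall A : set R,
      measurable A ->
      distribution (P b) (xi b ord_max) A = normal_prob aN 1 A)
    (lambda_roots : forall b : R, 0 < b -> forall mu : 'I_n.+1 -> R,
      decreasing_tuple mu ->
      {ae P b, forall w, ordered_corner_roots mu
                 (fun i => xi b i w) (fun i => lambda b mu i w)}) :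
  (forall mu : 'I_n.+1 -> R, decreasing_tuple mu ->
    (exists r : 'I_n -> R,
      [/\ ordered_poly_roots (deriv (Ppoly mu)) r,
          (forall x : R, root (deriv (Ppoly mu)) x <->
            (forall i, x != mu i) /\ \sum_(i < n.+1) (x - mu i)^-1 = 0),
          (forall i : 'I_n, mu (nxt i) < r i < mu (cur i)) &
          tuple_cvg_in_prob P
            (fun b i w => lambda b mu (nxt (cur i)) w) r]) /\
    cvg_in_prob P (fun b w => lambda b mu ord0 w / Num.sqrt b)
      (Num.sqrt (n.+1%:R / 2)) /\
    cvg_in_prob P (fun b w => lambda b mu ord_max w / Num.sqrt b)
      (- Num.sqrt (n.+1%:R / 2))) /\
  (forall m : 'I_n.+1 -> R, decreasing_tuple m ->
    exists r : 'I_n.+2 -> R,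
      [/\ ordered_poly_roots (deriv (Ppoly m) - (2 *: 'X) * Ppoly m) r,
          (forall x : R, (deriv (Ppoly m) - (2 *: 'X) * Ppoly m).[x] =
            expR (x ^+ 2) *
            derive1 (fun y : R => expR (- (y ^+ 2)) * (Ppoly m).[y]) x),
          interlaces r m &
          tuple_cvg_in_prob P
            (fun b i w =>
               lambda b (fun j => Num.sqrt b * m j) i w / Num.sqrt b) r]).
Proof.
have half_gt0 (i : 'I_n.+1) : 0 < 2^-1 :> R by rewrite invr_gt0.
have root_cvg := scaled_root_cvg xi_chi2 xi_normal lambda_roots.
have measurable_lambda b m i s : measurable_fun setT (fun w => lambda b m i w / s).
  by apply: measurable_funM.
have one_ratio : 1 / Num.sqrt b @[b --> +oo%R] --> (0 : R).
  under eq_cvg do rewrite div1r.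
  apply/gtr0_cvgV0; last exact: cvg_sqrt_pinfty.
  by near=> b; rewrite sqrtr_gt0.
have sqrt_ratio : Num.sqrt b / Num.sqrt b @[b --> +oo%R] --> (1 : R).
  apply/cvgrPdist_lt => e e0; near=> b.
  by rewrite divff ?subrr ?normr0// gt_eqF// sqrtr_gt0.
split=> [mu dmu|m dm].
  split; last first.
    (* at the scale [Num.sqrt b] the fixed poles merge at 0 *)
    have escape (j : 'I_n.+2) r : in_gap (fun _ : 'I_n.+1 => 0) j r ->
        r ^+ 2 = n.+1%:R / 2 ->
        cvg_in_prob P (fun b w => lambda b mu j w / Num.sqrt b) r.
      move=> gr r2; apply: cvg_in_probP => [b|]; first exact: measurable_lambda.
      apply: (root_cvg (fun=> mu) Num.sqrt 1 (fun=> 0) j r) => // [b b0|i|].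
      - by rewrite sqrtr_gt0.
      - rewrite -(mulr0 (mu i)); apply: cvgM; first exact: cvg_cst.
        apply/gtr0_cvgV0; last exact: cvg_sqrt_pinfty.
        by near=> b; rewrite sqrtr_gt0.
      - have r0 : r != 0 by have := in_gap_neq ord0 gr; rewrite subr0.
        rewrite /secular expr1n mul1r !subr0 sumr_const card_ord.
        apply: (mulIf r0); rewrite mul0r mulrBl -expr2 r2 -mulr_natl.
        by field.
    have c0 : 0 < n.+1%:R / 2 :> R by rewrite divr_gt0.
    split; apply: escape.
    - by move=> i; rewrite ltn0 sqrtr_gt0.
    - by rewrite sqr_sqrtr// ltW.
    - by move=> i; rewrite ltn_ord oppr_lt0 sqrtr_gt0.
    - by rewrite sqrrN sqr_sqrtr// ltW.
  have [||r [gr sr rr]] := @secular_gap_roots R n n (fun i : 'I_n => i.+1) 0 mu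
    dmu (lexx 0) _ _ (size_secular_poly0 mu).
  - by move=> i j; rewrite ltnS.
  - by move=> i; split; [rewrite ltnS ltnW|right; rewrite /= ltnS].
  exists r; split.
  - by rewrite -secular_poly0.
  - move=> x; rewrite -secular_poly0; split=> [rx|[xmu sx]].
      have [i xi_] := ordered_poly_roots_mem (secular_poly_neq0 _ (lexx 0)) rr rx.
      have xm j := in_gap_neq j (gr i); rewrite -xi_ in xm.
      split=> [j|]; first by rewrite -subr_eq0.
      move/(root_secular_poly _ xm): rx.
      rewrite /secular mul0r subr0 sub0r -mulr_sumr => /eqP.
      by rewrite oppr_eq0 mulf_eq0 invr_eq0 pnatr_eq0/= => /eqP.
    apply/root_secular_poly => [j|]; first by rewrite subr_eq0.
    by rewrite /secular mul0r subr0 sub0r -mulr_sumr sx mulr0 oppr0.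
  - move=> i; have := gr i (nxt i); have := gr i (cur i).
    by rewrite /= ltnS leqnn ltnn => -> ->.
  - apply: tuple_cvg_in_probP => [b i|i].
      by have := measurable_lambda b mu (nxt (cur i)) 1;
        under eq_fun do rewrite divr1.
    rewrite (_ : (fun t => _) = (fun t : {b : R & T b} =>
        lambda (tag t) mu (nxt (cur i)) (tagged t) / 1)); last first.
      by apply/funext => t; rewrite divr1.
    apply: (root_cvg (fun=> mu) (fun=> 1) 0 mu (nxt (cur i)) (r i)) => // [j||].
    + by rewrite divr1; exact: cvg_cst.
    + exact: gr.
    + by rewrite expr0n.
have [||r [gr sr rr]] := @secular_gap_roots R n n.+2 (fun i : 'I_n.+2 => i) 1 m
  dm ler01 _ _ (size_secular_poly1 m).
- by [].
- by move=> i; split; [exact: leq_ord|left].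
exists r; split.
- by rewrite -secular_poly1.
- by move=> x; exact: gauss_deriv_horner.
- move=> i; have := gr (cur i) i; have := gr (nxt i) i.
  by rewrite /= ltnn ltnS leqnn => /ltW -> /ltW ->.
- apply: tuple_cvg_in_probP => [b i|i]; first exact: measurable_lambda.
  apply: (root_cvg (fun b j => Num.sqrt b * m j) Num.sqrt 1 m i (r i)) => //.
  + by move=> b b0 j j' jj'; rewrite ltr_pM2l ?sqrtr_gt0//; exact: dm.
  + by move=> b b0; rewrite sqrtr_gt0.
  + move=> j; apply/cvgrPdist_lt => e e0; near=> b.
    by rewrite mulrAC divff ?mul1r ?subrr ?normr0// gt_eqF// sqrtr_gt0.
  + by rewrite expr1n.
Unshelve. all: end_near. Qed.
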